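(* Let $d$ be a positive integer and let $\mathcal{C}$ be a $d$-uniform decomposable clutter on the vertex set $[n]$, with clique complex $\Delta(\mathcal{C})$. Then the Alexander dual $\Delta(\mathcal{C})^\vee$ is shellable.
   Context: A clutter $\mathcal{C}$ on a finite vertex set $V$ is a collection of subsets of $V$ (called circuits) none of which is contained in another; it is $d$-uniform if every circuit has exactly $d$ elements. Write $V(\mathcal{C})$ for its vertex set (which may contain vertices lying in no circuit). A subclutter is a subset of $\mathcal{C}$ (on the same vertex set). The complete $d$-uniform clutter $\mathcal{C}_{n,d}$ on a vertex set $V$ with $|V|=n$ is $\{F\subseteq V: |F|=d\}$; if $n<d$ it consists of $n$ isolated vertices and no circuits. A subset $F\subseteq V$ is a clique in the $d$-uniform clutter $\mathcal{C}$ if either $|F|<d$ or all $d$-subsets of $F$ belong to $\mathcal{C}$. The clique complex $\Delta(\mathcal{C})$ is the simplicial complex of all cliques of $\mathcal{C}$; equivalently, its Stanley-Reisner ideal is generated by the monomials $\prod_{i\in F}x_i$ with $|F|=d$, $F\notin\mathcal{C}$. The Alexander dual of a simplicial complex $\Delta$ on $[n]$ is $\Delta^\vee=\{[n]\setminus F: F\subseteq[n],\ F\notin\Delta\}$ (here elements of $[n]$ are not required to be faces). A simplicial complex $\Delta$ is shellable if there is a total order $F_1,\ldots,F_t$ of its facets such that $\langle F_1,\ldots,F_{i-1}\rangle\cap\langle F_i\rangle$ is generated by a non-empty set of maximal proper faces of $F_i$ for $2\le i\le t$, where $\langle G_1,\ldots,G_s\rangle$ denotes the complex with facets $G_1,\dots,G_s$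 (a complex with no facets is vacuously shellable). For a $(d-1)$-subset $e$ of $V$, let $N_{\mathcal{C}}[e]=e\cup\{c\in V: e\cup\{c\}\in\mathcal{C}\}$; $e$ is simplicial over $\mathcal{C}$ if $N_{\mathcal{C}}[e]$ is a clique in $\mathcal{C}$. The deletion of $e$ is $\mathcal{C}\setminus e=\{F\in\mathcal{C}: e\nsubseteq F\}$. For a sequence $\mathbf{e}=e_1,\ldots,e_t$ of $(d-1)$-subsets put $\mathcal{C}_{\mathbf{e}}^0=\mathcal{C}$ and $\mathcal{C}_{\mathbf{e}}^i=(\mathcal{C}\setminus e_1)\setminus\cdots\setminus e_i$. Simplicial subclutter: a subclutter $\mathcal{D}\subsetneq\mathcal{C}$ is a simplicial subclutter of $\mathcal{C}$ if there are $(d-1)$-subsets $\mathbf{e}=e_1,\ldots,e_t$ of $V$ and sets $A_i\subseteq\{F\in\mathcal{C}_{\mathbf{e}}^{i-1}: e_i\subset F\}$, $i=1,\ldots,t$, such that $e_1$ is simplicial over $\mathcal{C}$, $e_i$ is simplicial over $\mathcal{C}\setminus A_1\setminus\cdots\setminus A_{i-1}$ for $i>1$ (set difference), and $\mathcal{D}=\mathcal{C}\setminus A_1\setminus\cdots\setminus A_t$. Decomposable clutters: the class of $d$-uniform decomposable clutters is defined recursively by: (i) $\mathcal{C}_{n,d}$ is decomposable; (ii) if $\mathcal{D}=\mathcal{C}_1\cup\mathcal{C}_2$ (on vertex set $V(\mathcal{C}_1)\cup V(\mathcal{C}_2)$), where $\mathcal{C}_1,\mathcal{C}_2$ are $d$-uniform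 decomposable clutters on $V(\mathcal{C}_1),V(\mathcal{C}_2)$ with $V(\mathcal{C}_1)\nsubseteq V(\mathcal{C}_2)$, $V(\mathcal{C}_2)\nsubseteq V(\mathcal{C}_1)$ and $V(\mathcal{C}_1)\cap V(\mathcal{C}_2)$ a clique in both $\mathcal{C}_1$ and $\mathcal{C}_2$, then $\mathcal{D}$ is decomposable; (iii) every simplicial subclutter of a decomposable clutter is decomposable. *)

(* Defs.v *)
From mathcomp Require Import all_boot.

Set Implicit Arguments.
Unset Strict Implicit.
Unset Printing Implicit Defensive.

(* A clutter is given by its vertex set [V] and its set of circuits [C], both
   over an ambient finite type [T]; [V] is kept separately because a vertex may
   lie in no circuit. *)

Section Clutters.
Variable T : finType.
Implicit Types (V F G e : {set T}) (C D : {set {set T}}).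

Definition clutter V C : Prop :=
  (forall F, F \in C -> F \subset V) /\
  (forall F G, F \in C -> G \in C -> F \subset G -> F = G).

Definition uniform (d : nat) C : Prop := forall F, F \in C -> #|F| = d.

Definition complete_clutter (d : nat) V : {set {set T}} :=
  [set F : {set T} | (F \subset V) && (#|F| == d)].

Definition clique (d : nat) V C F : bool :=
  (F \subset V) &&
  ((#|F| < d) ||
   [forall G : {set T}, (G \subset F) && (#|G| == d) ==> (G \in C)]).

Definition closed_nbhd V C e : {set T} :=
  e :|: [set c in V | c |: e \in C].

Definition simplicial (d : nat) V C e : bool :=
  clique d V C (closed_nbhd V C e).

Definition deletion C e : {set {set T}} := [set F in C | ~~ (e \subset F)].

(* Deletion of all the sets of a list, and removal of all the families of a
   list, from left to right. *)
Definition deletions C (es : seq {set T}) : {set {set T}} :=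
  foldl deletion C es.

Definition setminuses C (As : seq {set {set T}}) : {set {set T}} :=
  foldl (fun X A => X :\: A) C As.

(* Lists are indexed from 0, so that the i-th condition (i < t) is the one on
   e_(i+1) and A_(i+1).  The condition on [A_] involves the deletions of the
   e_j, whereas simpliciality is over [C] with only the A_j removed. *)
Definition simplicial_subclutter (d : nat) V C D : Prop :=
  D \proper C /\
  exists (es : seq {set T}) (As : seq {set {set T}}),
    [/\ size As = size es,
        forall e, e \in es -> (e \subset V) /\ #|e| = d.-1,
        forall i, i < size es ->
          nth set0 As i \subset
            [set F in deletions C (take i es) | nth set0 es i \subset F],
        forall i, i < size es ->
          simplicial d V (setminuses C (take i As)) (nth set0 es i)
      & D = setminuses C As].

(* [decomposable d V C]: the clutter with vertex set [V] and circuits [C] is a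
   d-uniform decomposable clutter.  A fixed ambient type loses nothing, since
   the pieces of a gluing have vertex sets contained in that of the result. *)
Inductive decomposable (d : nat) : {set T} -> {set {set T}} -> Prop :=
| decomposable_complete V :
    decomposable d V (complete_clutter d V)
| decomposable_glue V1 V2 C1 C2 :
    decomposable d V1 C1 -> decomposable d V2 C2 ->
    ~~ (V1 \subset V2) -> ~~ (V2 \subset V1) ->
    clique d V1 C1 (V1 :&: V2) -> clique d V2 C2 (V1 :&: V2) ->
    decomposable d (V1 :|: V2) (C1 :|: C2)
| decomposable_simplicial V C D :
    decomposable d V C -> simplicial_subclutter d V C D ->
    decomposable d V D.

Lemma decomposable_uniform_clutter d V C :
  decomposable d V C -> clutter V C /\ uniform d C.
Proof.
move=> decC.
suff sub F : F \in C -> F \subset V /\ #|F| = d.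
  split; last by move=> F /sub[].
  split=> [F /sub[]//|F G /sub[_ cF] /sub[_ cG] sFG].
  by apply/eqP; rewrite eqEcard sFG cF cG /=.
elim: decC F => {V C} [V|V1 V2 C1 C2 _ IH1 _ IH2 _ _ _ _|V C D _ IH [ltDC _]] F.
- by rewrite inE => /andP[? /eqP].
- rewrite inE => /orP[/IH1|/IH2] [sFV ->]; split=> //.
  + exact: subset_trans sFV (subsetUl _ _).
  + exact: subset_trans sFV (subsetUr _ _).
- by move/(subsetP (proper_sub ltDC))/IH.
Qed.

End Clutters.

(* A simplicial complex on a finite ground type is the set of its faces.  The
   void complex [set0] (no faces) and the complex [[set set0]] are distinct. *)
Section Complexes.
Variable T : finType.
Implicit Types (F G : {set T}) (Delta S : {set {set T}}).

Definition simplicial_complex Delta : Prop :=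
  forall F G, F \in Delta -> G \subset F -> G \in Delta.

Definition clique_complex (d : nat) (V : {set T}) (C : {set {set T}}) :
  {set {set T}} := [set F | clique d V C F].

(* The complement is taken in the whole of [T]. *)
Definition alexander_dual Delta : {set {set T}} :=
  [set ~: F | F : {set T} & F \notin Delta].

Definition facets Delta : {set {set T}} :=
  [set F | maxset (fun G => G \in Delta) F].

Definition generated_complex S : {set {set T}} :=
  [set F : {set T} | [exists G in S, F \subset G]].

(* Not necessarily pure. *)
Definition shellable Delta : Prop :=
  exists s : seq {set T},
    [/\ uniq s,
        s =i facets Delta
      & forall i, 0 < i < size s ->
        exists M : {set {set T}},
          [/\ M != set0,
              forall G, G \in M -> maxset (fun H => H \proper nth set0 s i) G
            & generated_complex [set G in take i s]
                :&: generated_complex [set nth set0 s i]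
              = generated_complex M]].

Lemma clique_complex_complex d V C : simplicial_complex (clique_complex d V C).
Proof.
move=> F G; rewrite !inE => /andP[sFV cF] sGF.
rewrite /clique (subset_trans sGF sFV) /=.
case/orP: cF => [ltFd|/forallP cF].
  by rewrite (leq_ltn_trans (subset_leq_card sGF) ltFd).
apply/orP; right; apply/forallP=> H; apply/implyP=> /andP[sHG cH].
by apply: (implyP (cF H)); rewrite (subset_trans sHG sGF).
Qed.

Lemma alexander_dual_complex Delta :
  simplicial_complex Delta -> simplicial_complex (alexander_dual Delta).
Proof.
move=> cD F G /imsetP[H]; rewrite inE => nH -> sG.
apply/imsetP; exists (~: G); last by rewrite setCK.
rewrite inE; apply: contra nH => /cD; apply; by rewrite -setCS setCK.
Qed.

End Complexes.

(* Main.v *)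
Require Import Defs.
From mathcomp Require Import all_boot.

(** The facets of the Alexander dual of the clique complex are the complements
    of the noncircuits, the d-subsets of the vertex set that are not circuits.
    They all have the same size, so a shelling of the dual is an enumeration of
    the noncircuits in which, for all G before H, some K before H satisfies
    K \subset G :|: H and #|K :\: H| = 1.  Algebraically, the ideal generated by
    the noncircuits has linear quotients.

    Such an enumeration survives each way of building a decomposable clutter.

    - A complete clutter has no noncircuit.
    - Let A be a set of circuits containing a simplicial e; removing A from the
      clutter appends A to the noncircuits.  If H in A and G is an older
      noncircuit, then G is not inside the clique N[e], and any y in G outside
      N[e] gives the older noncircuit K = y |: e.  Two elements of A differ in
      one vertex, so their order is irrelevant ([star_linear_quotients],
      [simplicial_removal]).
    - In a gluing along V1 :&: V2, the noncircuits are those of C1, those of C2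
      and the straddling sets, contained neither in V1 nor in V2.  The
      straddling d-sets are the bases of a matroid, and the bases of a matroid
      have linear quotients ([exchange_linear_quotients]).  They are listed
      first; then, as V1 :&: V2 is a clique, a noncircuit H of C1 meets
      V1 :\: V2, so replacing one of its vertices by a vertex outside V1 yields
      a straddling set ([straddling_exchange]), which settles every comparison
      between different groups. *)

Set Implicit Arguments.
Unset Strict Implicit.
Unset Printing Implicit Defensive.

(** * Families of sets with linear quotients *)

Section LinearQuotients.
Variable T : finType.
Implicit Types (V W F G H K e : {set T}) (N B C A : {set {set T}}).

Definition has_exchange N G H : Prop :=
  exists K, [/\ K \in N, K \subset G :|: H & #|K :\: H| = 1].

(** The order of the enumeration is the order in which the sets are added, so
    that families are combined without handling lists. *)
Inductive linear_quotients : {set {set T}} -> Prop :=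
| linear_quotients0 : linear_quotients set0
| linear_quotientsU1 H N :
    linear_quotients N -> H \notin N ->
    (forall G, G \in N -> has_exchange N G H) ->
    linear_quotients (H |: N).

Lemma has_exchangeS N B G H :
  N \subset B -> has_exchange N G H -> has_exchange B G H.
Proof. by move=> sNB [K [KN sK cK]]; exists K; split=> //; apply: (subsetP sNB). Qed.

Lemma linear_quotientsU N B :
    linear_quotients N -> linear_quotients B ->
    (forall G H, G \in N -> H \in B -> has_exchange N G H) ->
  linear_quotients (N :|: B).
Proof.
move=> lqN; elim=> {B} [|H B _ IH _ exB] exN; first by rewrite setU0.
have {}IH : linear_quotients (N :|: B).
  by apply: IH => G F GN FB; apply: exN => //; rewrite setU1r.
rewrite setUCA; have [HNB|HNB] := boolP (H \in N :|: B).
  by rewrite (setUidPr _) // sub1set.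
apply: linear_quotientsU1 => // G; rewrite inE => /orP[GN|GB].
  by apply: has_exchangeS (subsetUl N B) _; apply: exN; rewrite // setU11.
by apply: has_exchangeS (subsetUr N B) _; apply: exB.
Qed.

(** The hypothesis is the exchange property of the bases of a matroid.  If v
    separates two members of N, the members containing v are listed before the
    others: exchanging v into an H avoiding v gives the required K.  Both parts
    inherit the exchange property and are smaller. *)
Lemma exchange_linear_quotients N :
    (forall G H g, G \in N -> H \in N -> g \in G :\: H ->
      exists2 h, h \in H :\: G & g |: (H :\ h) \in N) ->
  linear_quotients N.
Proof.
have [m] := ubnP #|N|; elim: m N => // m IH N ltNm exN.
have [->|[G0 G0N]] := set_0Vmem N; first exact: linear_quotients0.
have [/existsP[H0 /andP[H0N neGH]]|/existsPn N1] :=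
  boolP [exists H in N, H != G0]; last first.
  have -> : N = G0 |: set0.
    apply/setP=> H; rewrite !inE orbF; apply/idP/eqP=> [HN|-> //].
    by move: (N1 H); rewrite HN negbK => /eqP.
  apply: linear_quotientsU1; [exact: linear_quotients0|by rewrite inE|].
  by move=> G; rewrite inE.
have [v [G [H [GN HN vG vH]]]] :
    exists v G H, [/\ G \in N, H \in N, v \in G & v \notin H].
  have [sHG|/subsetPn[v vH vG]] := boolP (H0 \subset G0); last first.
    by exists v, H0, G0.
  have /subsetPn[v vG vH] : ~~ (G0 \subset H0).
    by apply: contra neGH => sGH; rewrite eqEsubset sHG.
  by exists v, G0, H0.
pose Nv := [set F in N | v \in F]; pose Nw := [set F in N | v \notin F].
have -> : N = Nv :|: Nw.
  by apply/setP=> F; rewrite !inE; case: (F \in N); case: (v \in F).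
apply: linear_quotientsU.
- apply: IH.
    rewrite (leq_trans _ (ltnSE ltNm)) //; apply: proper_card; apply/properP.
    split; first by apply/subsetP=> F; rewrite inE => /andP[].
    by exists H => //; rewrite inE HN (negbTE vH).
  move=> P Q g; rewrite !inE => /andP[PN vP] /andP[QN vQ] /andP[gQ gP].
  have [|h] := exN P Q g PN QN; first by rewrite inE gP gQ.
  rewrite inE => /andP[hP hQ] KN; exists h; first by rewrite inE hP.
  rewrite !inE KN vQ; have [eqv|] := eqVneq v h; last by rewrite orbT.
  by rewrite -eqv vP in hP.
- apply: IH.
    rewrite (leq_trans _ (ltnSE ltNm)) //; apply: proper_card; apply/properP.
    split; first by apply/subsetP=> F; rewrite inE => /andP[].
    by exists G => //; rewrite inE GN vG.
  move=> P Q g; rewrite !inE => /andP[PN vP] /andP[QN vQ] /andP[gQ gP].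
  have [|h] := exN P Q g PN QN; first by rewrite inE gP gQ.
  rewrite inE => /andP[hP hQ] KN; exists h; first by rewrite inE hP.
  rewrite !inE KN (negbTE vQ) andbF orbF /=.
  by apply: contraNneq vP => ->.
move=> P Q; rewrite !inE => /andP[PN vP] /andP[QN vQ].
have [|h] := exN P Q v PN QN; first by rewrite inE vP vQ.
rewrite inE => /andP[hP hQ] KN; exists (v |: Q :\ h); split.
- by rewrite !inE KN eqxx.
- rewrite subUset sub1set inE vP /=.
  exact: subset_trans (subsetDl _ _) (subsetUr _ _).
- apply/eqP/cards1P; exists v; apply/setP=> x; rewrite !inE.
  by case: eqVneq => [->|_]; rewrite ?vQ //=; case: (x \in Q); rewrite ?andbF.
Qed.

Lemma superset_succ_card e F :
  e \subset F -> #|F| = #|e|.+1 -> exists2 x, x \notin e & F = x |: e.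
Proof.
move=> sef cF; have /eqP/cards1P[x Fe] : #|F :\: e| = 1.
  by rewrite cardsDS // cF subSnn.
have : x \in F :\: e by rewrite Fe inE.
rewrite inE => /andP[xe xF]; exists x => //.
by rewrite -Fe setUC -{1}(setIidPr sef) setID.
Qed.

Lemma star_linear_quotients e A :
    (forall F, F \in A -> e \subset F /\ #|F| = #|e|.+1) ->
  linear_quotients A.
Proof.
move=> starA; apply: exchange_linear_quotients => G H g GA HA.
have [/superset_succ_card sG /sG[a ae eG]] := starA G GA.
have [/superset_succ_card sH /sH[b be eH]] := starA H HA.
rewrite {1}eG eH !inE => /andP[/norP[gb ge]].
rewrite (negbTE ge) orbF => /eqP eq_ga; exists b.
  by rewrite !inE eqxx eG !inE (negbTE be) orbF -eq_ga eq_sym gb.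
by rewrite setU1K // eq_ga -eG.
Qed.

(** * Removing circuits through a simplicial set *)

Definition noncircuits d V C := complete_clutter d V :\: C.

Lemma noncircuitsP d V C F :
  reflect [/\ F \subset V, #|F| = d & F \notin C] (F \in noncircuits d V C).
Proof.
rewrite !inE; apply: (iffP and3P); first by case=> ? ? /eqP.
by case=> ? /eqP ? ?.
Qed.
Arguments noncircuitsP {d V C F}.

Lemma clique_circuit d V C F G :
  clique d V C F -> G \subset F -> #|G| = d -> G \in C.
Proof.
case/andP=> _ /orP[ltF|/forallP/(_ G)/implyP cF] sGF cG; last first.
  by rewrite cF // sGF cG /=.
by move: (subset_leq_card sGF); rewrite cG leqNgt ltF.
Qed.

(** The removed circuits are appended as one block.  An older noncircuit G has a
    vertex y outside N[e], because circuits fill the clique N[e]; and y |: e is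
    then a noncircuit that was present before the whole block. *)
Lemma simplicial_removal d V C A e :
    0 < d -> e \subset V -> #|e| = d.-1 -> simplicial d V C e ->
    (forall F, F \in A -> e \subset F) ->
    linear_quotients (noncircuits d V C) ->
  linear_quotients (noncircuits d V (C :\: A)).
Proof.
move=> d0 seV ce simp_e starA lqC.
have ce1 : #|e|.+1 = d by rewrite ce prednK.
have -> : noncircuits d V (C :\: A) =
    noncircuits d V C :|: (complete_clutter d V :&: C :&: A).
  apply/setP=> F; rewrite !inE.
  by case: (F \in C); case: (F \in A); case: (F \subset V); case: (#|F| == d).
apply: linear_quotientsU => //.
  apply: (@star_linear_quotients e) => F; rewrite !inE.
  by case/andP=> /andP[/andP[_ /eqP ->] _] /starA sF.
move=> G H /noncircuitsP[sGV cG GC].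
rewrite !inE => /andP[/andP[/andP[sHV /eqP cH] HC] /starA seH].
have [|b be eH] := superset_succ_card seH; first by rewrite cH ce1.
have sHN : H \subset closed_nbhd V C e.
  rewrite eH subUset subsetUl andbT sub1set !inE -eH HC andbT.
  by rewrite (subsetP sHV) ?orbT // eH setU11.
have /subsetPn[y yG yN] : ~~ (G \subset closed_nbhd V C e).
  by apply: contra GC => sGN; apply: clique_circuit simp_e sGN cG.
have yV := subsetP sGV y yG.
move: (yN); rewrite !inE yV => /norP[ye yeC].
exists (y |: e); split.
- apply/noncircuitsP; split=> //; first by rewrite subUset sub1set yV.
  by rewrite cardsU1 ye.
- by rewrite subUset sub1set inE yG /= subsetU // seH orbT.
- have yH : y \notin H by apply: contra yN; apply: (subsetP sHN).
  apply/eqP/cards1P; exists y; apply/setP=> x; rewrite !inE.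
  case: eqVneq => [->|_]; first by rewrite yH.
  by apply/negP=> /andP[/negP xH /(subsetP seH)].
Qed.

Lemma simplicial_subclutter_linear_quotients d V C D :
    0 < d -> simplicial_subclutter d V C D ->
    linear_quotients (noncircuits d V C) ->
  linear_quotients (noncircuits d V D).
Proof.
move=> d0 [_ [es [As [sz es_sub starA simp ->]]]] lqC.
rewrite -(take_size As); have := leqnn (size As); move: {1 3}(size As) => i.
elim: i => [|i IH] ltiA; first by rewrite take0.
rewrite (take_nth set0 ltiA) /setminuses foldl_rcons.
have ltie : i < size es by rewrite -sz.
have [sV ce] := es_sub _ (mem_nth set0 ltie).
apply: (simplicial_removal d0 sV ce (simp i ltie)); last exact: IH (ltnW ltiA).
by move=> F /(subsetP (starA i ltie)); rewrite inE => /andP[].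
Qed.

(** * Gluing along a clique *)

Definition straddling d V1 V2 : {set {set T}} :=
  [set F in complete_clutter d (V1 :|: V2)
     | ~~ (F \subset V1) && ~~ (F \subset V2)].

Lemma straddlingP d V1 V2 F :
  reflect [/\ F \subset V1 :|: V2, #|F| = d, ~~ (F \subset V1)
            & ~~ (F \subset V2)] (F \in straddling d V1 V2).
Proof.
rewrite !inE; apply: (iffP andP) => [[/andP[? /eqP ?] /andP[]]|[-> -> -> ->]] //.
by rewrite eqxx.
Qed.
Arguments straddlingP {d V1 V2 F}.

Lemma straddlingC d V1 V2 : straddling d V1 V2 = straddling d V2 V1.
Proof. by apply/setP=> F; rewrite !inE setUC [~~ _ && ~~ _]andbC. Qed.

(** When H is to receive g, it has to keep a vertex x outside V.  A common
    vertex of G and g |: H outside V can always be kept; when there is none,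
    G has a further vertex z outside both V and g |: H, and this extra element
    of G :\: H pays for the one element x of H :\: G that must not be dropped. *)
Lemma kept_vertex V G H g :
    ~~ (G \subset V) -> ~~ (H \subset V) -> g \in G ->
  exists x, [/\ x \notin V, x \in g |: H
    & x \in G \/ exists z, [/\ z \in G :\: H, z \notin V & z != g]].
Proof.
move=> /subsetPn[z zG zV] /subsetPn[x xH xV] gG.
have [zgH|] := boolP (z \in g |: H); first by exists z; split=> //; left.
rewrite !inE => /norP[zg zH]; exists x; rewrite !inE xH orbT; split=> //.
by right; exists z; rewrite inE zH.
Qed.

Lemma straddling_linear_quotients d V1 V2 :
  linear_quotients (straddling d V1 V2).
Proof.
apply: exchange_linear_quotients => G H g GM HM /setDP[gG gH].
case/straddlingP: GM => sGV cG nG1 nG2; case/straddlingP: HM => sHV cH nH1 nH2.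
have [y [yV1 ygH y_kept]] := kept_vertex nG1 nH1 gG.
have [x [xV2 xgH x_kept]] := kept_vertex nG2 nH2 gG.
have cGH : #|G :\: H| = #|H :\: G| by rewrite !cardsD cG cH setIC.
(* Dropping from g |: H any h other than x and y leaves a straddling set. *)
suff /set0Pn[h] : (H :\: G) :\: [set x; y] != set0.
  rewrite !inE => /andP[/norP[hx hy] /andP[hG hH]].
  exists h; first by rewrite inE hG.
  have hg : h != g by apply: contraNneq hG => ->.
  have eqK : g |: (H :\ h) = (g |: H) :\ h.
    apply/setP=> t; rewrite !inE; case: (eqVneq t g) => [->|//].
    by rewrite (eq_sym g) hg.
  rewrite eqK; apply/straddlingP; split.
  - apply: subset_trans (subsetDl _ _) _.
    by rewrite subUset sHV sub1set (subsetP sGV).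
  - have := cardsD1 h (g |: H).
    by rewrite cardsU1 gH !inE hH orbT cH => /eqP; rewrite eqn_add2l => /eqP.
  - apply/subsetPn; exists y => //.
    by rewrite in_setD1 eq_sym hy.
  - apply/subsetPn; exists x => //.
    by rewrite in_setD1 eq_sym hx.
have sub_gz (Z : {set T}) : Z \subset G :\: H -> g \notin Z -> #|Z| < #|G :\: H|.
  move=> sZ gZ; have <- : #|g |: Z| = #|Z|.+1 by rewrite cardsU1 gZ.
  by apply: subset_leq_card; rewrite subUset sZ sub1set inE gH gG.
rewrite -card_gt0 cardsD subn_gt0 -cGH.
case: x_kept y_kept => [xG|[zx [zxGH zxV2 zxg]]] [yG|[zy [zyGH zyV1 zyg]]].
- apply: leq_ltn_trans (sub_gz set0 _ _); rewrite ?inE ?sub0set //.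
  apply: subset_leq_card; apply/subsetP=> t; rewrite !inE.
  by case/andP=> /andP[tG _] /orP[]/eqP eqt; rewrite eqt ?xG ?yG in tG.
- apply: leq_ltn_trans (sub_gz [set zy] _ _); last by rewrite inE eq_sym.
    rewrite cards1 -(cards1 y); apply: subset_leq_card.
    apply/subsetP=> t; rewrite !inE => /andP[/andP[tG _]].
    by case/orP=> // /eqP eqt; rewrite eqt xG in tG.
  by rewrite sub1set.
- apply: leq_ltn_trans (sub_gz [set zx] _ _); last by rewrite inE eq_sym.
    rewrite cards1 -(cards1 x); apply: subset_leq_card.
    apply/subsetP=> t; rewrite !inE => /andP[/andP[tG _]].
    by case/orP=> // /eqP eqt; rewrite eqt yG in tG.
  by rewrite sub1set.
apply: leq_ltn_trans (sub_gz [set zx; zy] _ _).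
- have zxy : zx != zy.
    apply: contraNneq zyV1 => <-; move: zxGH; rewrite inE => /andP[_ /(subsetP sGV)].
    by rewrite inE (negbTE zxV2) orbF.
  rewrite [leqRHS]cards2 zxy (leq_trans (subset_leq_card (subsetIr _ _))) //.
  by rewrite cards2; case: (x != y).
- by rewrite subUset !sub1set zxGH.
- by rewrite !inE negb_or eq_sym zxg eq_sym.
Qed.

Lemma straddling_exchange d V1 V2 G H :
    1 < d -> H \subset V1 -> #|H| = d -> ~~ (H \subset V2) ->
    G \subset V1 :|: V2 -> ~~ (G \subset V1) ->
  has_exchange (straddling d V1 V2) G H.
Proof.
move=> d1 sHV1 cH /subsetPn[x xH xV2] sGV /subsetPn[y yG yV1].
have /set0Pn[h] : H :\ x != set0.
  by rewrite -card_gt0 -ltnS; move: d1; rewrite -cH (cardsD1 x) xH.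
rewrite !inE => /andP[hx hH].
have yH : y \notin H by apply: contra yV1; apply: (subsetP sHV1).
exists (y |: H :\ h); split.
- apply/straddlingP; split.
  + rewrite subUset sub1set (subsetP sGV) //=.
    exact: subset_trans (subsetDl _ _) (subset_trans sHV1 (subsetUl _ _)).
  + by rewrite cardsU1 !inE (negbTE yH) andbF -cH (cardsD1 h H) hH.
  + by apply/subsetPn; exists y => //; rewrite setU11.
  + by apply/subsetPn; exists x => //; rewrite !inE xH (eq_sym x h) hx orbT.
- rewrite subUset sub1set inE yG /=.
  exact: subset_trans (subsetDl _ _) (subsetUr _ _).
- apply/eqP/cards1P; exists y; apply/setP=> t; rewrite !inE.
  by case: eqVneq => [->|_]; rewrite ?yH //=; case: (t \in H); rewrite ?andbF.
Qed.

Lemma glue_linear_quotients d V1 V2 C1 C2 :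
    1 < d -> C1 \subset complete_clutter d V1 -> C2 \subset complete_clutter d V2 ->
    clique d V1 C1 (V1 :&: V2) -> clique d V2 C2 (V1 :&: V2) ->
    linear_quotients (noncircuits d V1 C1) ->
    linear_quotients (noncircuits d V2 C2) ->
  linear_quotients (noncircuits d (V1 :|: V2) (C1 :|: C2)).
Proof.
move=> d1 /subsetP sC1 /subsetP sC2 cl1 cl2 lq1 lq2.
have N1V2 F : F \in noncircuits d V1 C1 -> ~~ (F \subset V2).
  case/noncircuitsP=> sFV1 cF; apply: contra => sFV2.
  by apply: clique_circuit cl1 _ cF; rewrite subsetI sFV1.
have N2V1 F : F \in noncircuits d V2 C2 -> ~~ (F \subset V1).
  case/noncircuitsP=> sFV2 cF; apply: contra => sFV1.
  by apply: clique_circuit cl2 _ cF; rewrite subsetI sFV1.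
have -> : noncircuits d (V1 :|: V2) (C1 :|: C2) =
    straddling d V1 V2 :|: noncircuits d V1 C1 :|: noncircuits d V2 C2.
  apply/setP=> F; apply/idP/idP => [/noncircuitsP[sFV cF]|].
    rewrite inE => /norP[nF1 nF2]; rewrite 2!inE -orbA.
    have [sF1|nsF1] := boolP (F \subset V1).
      by apply/or3P/Or32/noncircuitsP.
    have [sF2|nsF2] := boolP (F \subset V2).
      by apply/or3P/Or33/noncircuitsP.
    by apply/or3P/Or31/straddlingP.
  rewrite 2!inE -orbA => /or3P[/straddlingP[sFV cF nF1 nF2]|FN|FN].
  - apply/noncircuitsP; split=> //; rewrite inE negb_or.
    apply/andP; split; [apply: contra nF1|apply: contra nF2].
      by move/sC1; rewrite inE => /andP[].
    by move/sC2; rewrite inE => /andP[].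
  - have [sF1 cF nF1] := noncircuitsP FN; apply/noncircuitsP; split=> //.
      exact: subset_trans sF1 (subsetUl _ _).
    rewrite inE (negbTE nF1) /=; apply: contra (N1V2 F FN).
    by move/sC2; rewrite inE => /andP[].
  - have [sF2 cF nF2] := noncircuitsP FN; apply/noncircuitsP; split=> //.
      exact: subset_trans sF2 (subsetUr _ _).
    rewrite inE (negbTE nF2) orbF; apply: contra (N2V1 F FN).
    by move/sC1; rewrite inE => /andP[].
apply: linear_quotientsU => //.
  apply: linear_quotientsU => // [|G H GM HN1].
    exact: straddling_linear_quotients.
  have [sGV _ nG1 _] := straddlingP GM; have [sH1 cH _] := noncircuitsP HN1.
  by apply: straddling_exchange => //; apply: N1V2.
move=> G H GMN HN2; have [sH2 cH _] := noncircuitsP HN2.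
apply: has_exchangeS (subsetUl _ _) _; rewrite straddlingC.
apply: straddling_exchange => //; first exact: N2V1.
  rewrite setUC; case/setUP: GMN => [/straddlingP[]//|/noncircuitsP[sG1 _ _]].
  exact: subset_trans sG1 (subsetUl _ _).
by case/setUP: GMN => [/straddlingP[]//|/N1V2].
Qed.

Lemma decomposable_linear_quotients d V C :
  0 < d -> decomposable d V C -> linear_quotients (noncircuits d V C).
Proof.
move=> d0; elim=> {V C} [V|V1 V2 C1 C2 dec1 lq1 dec2 lq2 _ _ cl1 cl2|V C D _ lqC sD].
- by rewrite /noncircuits setDv; apply: linear_quotients0.
- have dec_sub V C : decomposable d V C -> C \subset complete_clutter d V.
    case/decomposable_uniform_clutter=> [[sCV _] uC]; apply/subsetP=> F FC.
    by rewrite inE sCV //= uC.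
  have [d1|] := ltnP 1 d; first by apply: glue_linear_quotients; auto.
  (* Singletons all contain the empty set, so any order of them will do; there
     are no straddling sets to exchange through. *)
  rewrite leq_eqVlt ltnS leqNgt d0 orbF => /eqP d1.
  apply: (@star_linear_quotients set0) => F /noncircuitsP[_ -> _].
  by rewrite sub0set cards0.
- exact: simplicial_subclutter_linear_quotients sD lqC.
Qed.

(** * From linear quotients to shellings of the dual *)

Lemma linear_quotients_seq N :
    linear_quotients N ->
  exists s : seq {set T}, [/\ uniq s, s =i N &
    forall i G, i < size s -> G \in take i s ->
      exists K, [/\ K \in take i s, K \subset G :|: nth set0 s i
                  & #|K :\: nth set0 s i| = 1]].
Proof.
elim=> {N} [|H N _ [s [uniq_s sN ex_s]] HN exN].
  by exists [::]; split=> // F; rewrite inE.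
exists (rcons s H); split.
- by rewrite rcons_uniq sN HN.
- by move=> F; rewrite mem_rcons !inE sN.
move=> i G; rewrite size_rcons ltnS leq_eqVlt => /orP[/eqP ->|lti].
  rewrite -cats1 take_size_cat // nth_cat ltnn subnn sN => /exN[K [KN sK cK]].
  by exists K; rewrite sN.
by rewrite -cats1 take_cat nth_cat lti; apply: ex_s.
Qed.

Lemma dual_clique_complex d C :
  alexander_dual (clique_complex d [set: T] C) =
  generated_complex [set ~: G | G in noncircuits d [set: T] C].
Proof.
apply/setP=> F; rewrite inE; apply/imsetP/exists_inP => [[F']|].
  rewrite !inE /clique subsetT negb_or -leqNgt => /andP[_ /forallPn[G]].
  rewrite negb_imply => /andP[/andP[sGF /eqP cG] GC] ->.
  by exists (~: G); rewrite ?setCS ?imset_f //; apply/noncircuitsP.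
case=> _ /imsetP[G /noncircuitsP[_ cG GC] ->]; rewrite subsetC => sGF.
exists (~: F); last by rewrite setCK.
by rewrite !inE; apply: contra GC => clF; apply: clique_circuit clF sGF cG.
Qed.

(** Sets of equal size are pairwise incomparable, hence each of them is maximal
    in the complex they generate. *)
Lemma facets_generated_uniform m (S : {set {set T}}) :
  uniform m S -> facets (generated_complex S) = S.
Proof.
move=> uS; apply/setP=> F; rewrite inE; apply/maxsetP/idP => [[]|FS].
  rewrite inE => /exists_inP[G GS sFG] maxF; rewrite -(maxF G) // inE.
  by apply/exists_inP; exists G.
split=> [|G]; first by rewrite inE; apply/exists_inP; exists F.
rewrite inE => /exists_inP[H HS sGH] sFG.
have eqFH : F = H.
  by apply/eqP; rewrite eqEcard (subset_trans sFG sGH) uS // uS /=.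
by apply/eqP; rewrite eqEsubset sFG eqFH sGH.
Qed.

Lemma maxset_properD1 F x : x \in F -> maxset (fun H => H \proper F) (F :\ x).
Proof.
move=> xF; apply/maxsetP; split=> [|H ltHF sFxH]; first exact: properD1.
apply/esym/eqP; rewrite eqEcard sFxH -ltnS.
by have := proper_card ltHF; rewrite (cardsD1 x F) xF.
Qed.

(** Passing to complements turns K :\: H = [set v] with K \subset G :|: H into:
    ~: H :&: ~: K is the codimension-one face of ~: H opposite to v, and it
    contains ~: H :&: ~: G.  These faces generate the intersection required of
    a shelling. *)
Lemma shellable_complements m N :
    uniform m N -> linear_quotients N ->
  shellable (generated_complex [set ~: G | G in N]).
Proof.
move=> uN /linear_quotients_seq[s [uniq_s sN ex_s]].
exists (map (@setC T) s); split.
- by rewrite map_inj_uniq //; apply: setC_inj.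
- rewrite (facets_generated_uniform (m := #|T| - m)) => [F|F].
    apply/mapP/imsetP => -[G GN ->]; exists G => //; by rewrite ?sN // -sN.
  by case/imsetP=> G /uN cG ->; rewrite -cG -(cardsC G) addKn.
move=> i /andP[i0]; rewrite size_map => lti.
rewrite (nth_map set0) // -map_take; set H := nth _ s i.
have {}ex_s G : G \in take i s -> exists K,
    [/\ K \in take i s, K \subset G :|: H & #|K :\: H| = 1] by apply: ex_s.
exists [set ~: (H :|: K) | K in [set K in take i s | #|K :\: H| == 1]]; split.
- have [K [Ks _ cK]] : exists K, [/\ K \in take i s,
      K \subset nth set0 s 0 :|: H & #|K :\: H| = 1].
    apply: ex_s; rewrite -(nth_take _ i0) mem_nth // size_take lti //.
  apply/set0Pn; exists (~: (H :|: K)).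
  by apply/imsetP; exists K; rewrite // inE Ks cK.
- move=> F /imsetP[K]; rewrite inE => /andP[_ /cards1P[v eqv]] ->.
  have vKH : v \in K :\: H by rewrite eqv inE.
  suff -> : ~: (H :|: K) = ~: H :\ v.
    by apply: maxset_properD1; move: vKH; rewrite !inE => /andP[].
  by rewrite -eqv; apply/setP=> t; rewrite !inE; case: (t \in H); case: (t \in K).
apply/setP=> P; rewrite !inE; apply/andP/exists_inP => [[]|].
  case/exists_inP=> F; rewrite inE => /mapP[G Gs ->] sPG.
  case/exists_inP=> F'; rewrite inE => /eqP -> sPH.
  have [K [Ks sK cK]] := ex_s G Gs.
  exists (~: (H :|: K)).
    by apply/imsetP; exists K; rewrite // inE Ks cK.
  rewrite subsetC subUset -subsetC sPH /=.
  apply: subset_trans sK _; rewrite subUset.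
  by rewrite -subsetC sPG -subsetC sPH.
case=> F /imsetP[K]; rewrite inE => /andP[Ks _] ->.
rewrite setCU subsetI => /andP[sPH sPK].
split; apply/exists_inP.
  by exists (~: K); rewrite // inE; apply: map_f.
by exists (~: H); rewrite // inE.
Qed.

End LinearQuotients.

Theorem corollary2p6 (d n : nat) (C : {set {set 'I_n}}) (hd : 0 < d)
    (hC : decomposable d [set: 'I_n] C) :
  shellable (alexander_dual (clique_complex d [set: 'I_n] C)).
Proof.
rewrite dual_clique_complex; apply: (shellable_complements (m := d)).
  by move=> F /noncircuitsP[].
exact: decomposable_linear_quotients.
Qed.
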